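(* Let $A,B$, the generalized cosines $c_1,\dots,c_n$, $H$, $S$, $P_S$, $P=\psi_d(S)$ and $\Delta_{\min}$ be as described in the context, for an interval $[c_{\min},c_{\max}]\subset[0,1]$ and series degree $d$. Then $$|\mathrm{tr}(P_S)-\mathrm{tr}(P)|\le\frac{n\pi^6}{2(d+2)^3\Delta_{\min}^4}.$$
   Context: $A\in\mathbb{R}^{m_1\times n}$, $B\in\mathbb{R}^{m_2\times n}$, $m_1+m_2\ge n$, $[A^T,B^T]^T$ of full column rank. GSVD: $U^TAX=\Sigma_A$, $V^TBX=\Sigma_B$ with $X$ nonsingular, $U,V$ orthogonal, $\Sigma_A^T\Sigma_A=\mathrm{diag}(c_1^2,\dots,c_n^2)$, $\Sigma_B^T\Sigma_B=\mathrm{diag}(s_1^2,\dots,s_n^2)$, $c_i,s_i\ge0$, $c_i^2+s_i^2=1$ (values $c_i=0$ and $c_i=1$ correspond to $\mathcal N(A)$ and $\mathcal N(B)$). $H=A^TA+B^TB$, $X^THX=I$, $S=H^{-1}(A^TA-B^TB)=X(2\Sigma_A^T\Sigma_A-I)X^{-1}$. $P_S=X_{in}X_{in}^TH+\frac12X_eX_e^TH$, where $X_{in}$ (resp. $X_e$) consists of the columns $x_i$ of $X$ with $c_i\in(c_{\min},c_{\max})$ (resp. $c_i\in\{c_{\min},c_{\max}\}$). With $l(z)=2z^2-1$, $\alpha=\arccos(l(c_{\min}))$, $\beta=\arccos(l(c_{\max}))$, $\eta_0=(\alpha-\beta)/\pi$, $\eta_j=2(\sin(j\alpha)-\sin(j\beta))/(j\pi)$,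 $\rho_{j,d}=\frac{(d+2-j)\sin\frac{\pi}{d+2}\cos\frac{j\pi}{d+2}+\cos\frac{\pi}{d+2}\sin\frac{j\pi}{d+2}}{(d+2)\sin\frac{\pi}{d+2}}$, let $\psi_d(x)=\sum_{j=0}^d\rho_{j,d}\eta_jT_j(x)$ ($T_j$ Chebyshev polynomials) and $P=\psi_d(S)$. $\Delta_{\min}=\min\{\Delta_{il},\Delta_{ir},\Delta_{ol},\Delta_{or}\}$ with $\Delta_{il}=|\arccos(l(c_{il}))-\alpha|$, $\Delta_{ir}=|\arccos(l(c_{ir}))-\beta|$, $\Delta_{ol}=|\arccos(l(c_{ol}))-\alpha|$, $\Delta_{or}=|\arccos(l(c_{or}))-\beta|$, where $c_{il},c_{ir}$ (resp. $c_{ol},c_{or}$) are the values among $c_1,\dots,c_n$ closest to $c_{\min}$ and $c_{\max}$ inside (resp. outside) $[c_{\min},c_{\max}]$. *)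

(* Defs.v *)
From mathcomp Require Import all_boot all_order all_algebra.
From mathcomp Require Import reals trigo.
Set Implicit Arguments. Unset Strict Implicit. Unset Printing Implicit Defensive.
Import Order.TTheory GRing.Theory Num.Theory.
Local Open Scope ring_scope.

Section GSVDDefs.
Variable R : realType.

Definition lmap (z : R) : R := 2 * z ^+ 2 - 1.

Definition alpha_of (cmin : R) : R := acos (lmap cmin).
Definition beta_of (cmax : R) : R := acos (lmap cmax).

Definition eta_coef (cmin cmax : R) (j : nat) : R :=
  let a := alpha_of cmin in let b := beta_of cmax in
  if j == 0%N then (a - b) / pi
  else 2 * (sin (j%:R * a) - sin (j%:R * b)) / (j%:R * pi).

Definition rho_coef (d j : nat) : R :=
  let N : R := (d + 2)%:R in
  let t := pi / N in
  ((N - j%:R) * sin t * cos (j%:R * t) + cos t * sin (j%:R * t))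
  / (N * sin t).

Fixpoint cheb_pair (n : nat) (S : 'M[R]_n) (j : nat) : 'M[R]_n * 'M[R]_n :=
  match j with
  | 0 => (1%:M, S)
  | j'.+1 => let p := cheb_pair S j' in (p.2, 2 *: (S *m p.2) - p.1)
  end.
Definition cheb_mx (n : nat) (S : 'M[R]_n) (j : nat) : 'M[R]_n :=
  (cheb_pair S j).1.

Definition psi_mx (cmin cmax : R) (d : nat) (n : nat) (S : 'M[R]_n) : 'M[R]_n :=
  \sum_(j < d.+1) (rho_coef d j * eta_coef cmin cmax j) *: cheb_mx S j.

(* P_S = X_in X_in^T H + 1/2 X_e X_e^T H *)
Definition PS_weight (cmin cmax ci : R) : R :=
  if (cmin < ci) && (ci < cmax) then 1
  else if (ci == cmin) || (ci == cmax) then 2^-1 else 0.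

Definition PS_mx (n : nat) (cmin cmax : R) (c : 'I_n -> R)
    (X H : 'M[R]_n) : 'M[R]_n :=
  \sum_(i < n) PS_weight cmin cmax (c i) *: ((col i X *m (col i X)^T) *m H).

Definition seqmin (s : seq R) : option R :=
  if s is x :: s' then Some (foldr Num.min x s') else None.
Definition seqmax (s : seq R) : option R :=
  if s is x :: s' then Some (foldr Num.max x s') else None.

(* c_il, c_ir: values among the c_i closest to cmin, cmax inside [cmin,cmax];
   c_ol: closest to cmin outside (i.e. largest c_i < cmin);
   c_or: closest to cmax outside (i.e. smallest c_i > cmax). *)
Definition c_il n (cmin cmax : R) (c : 'I_n -> R) : option R :=
  seqmin [seq c i | i <- enum 'I_n & (cmin <= c i <= cmax)].
Definition c_ir n (cmin cmax : R) (c : 'I_n -> R) : option R :=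
  seqmax [seq c i | i <- enum 'I_n & (cmin <= c i <= cmax)].
Definition c_ol n (cmin : R) (c : 'I_n -> R) : option R :=
  seqmax [seq c i | i <- enum 'I_n & c i < cmin].
Definition c_or n (cmax : R) (c : 'I_n -> R) : option R :=
  seqmin [seq c i | i <- enum 'I_n & cmax < c i].

(* Delta_min = min of those Delta_{il},Delta_{ir},Delta_{ol},Delta_{or} that exist
   (0 if none exists, which only happens for n = 0). *)
Definition Delta_min n (cmin cmax : R) (c : 'I_n -> R) : R :=
  let a := alpha_of cmin in let b := beta_of cmax in
  let D (o : option R) (t : R) := omap (fun z => `|acos (lmap z) - t|) o in
  odflt 0 (seqmin (pmap id [:: D (c_il cmin cmax c) a; D (c_ir cmin cmax c) b;
                               D (c_ol cmin c) a; D (c_or cmax c) b])).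

End GSVDDefs.

(* Main.v *)
Require Import Defs.
From mathcomp Require Import all_boot all_order all_algebra.
From mathcomp Require Import ring lra.
From mathcomp Require Import reals normedtype derive realfun trigo.
Import Order.TTheory GRing.Theory Num.Theory.
Import numFieldNormedType.Exports.
Local Open Scope ring_scope.
Set Implicit Arguments. Unset Strict Implicit. Unset Printing Implicit Defensive.

(** Conjugating by [X] reduces both traces to sums over the angles
    [th_i = acos (2 c_i^2 - 1)], so it is enough to bound the error at each angle.
    There [psi_d (cos th)] is the convolution of the even indicator function of
    [beta < |t| < alpha] with the Jackson kernel [K].  The kernel is nonnegative,
    being the squared modulus of a trigonometric polynomial, hence the error is at
    most the mass of [K] outside [[-Delta, Delta]].  By Chebyshev's inequality for
    the weight [(1 - cos t)^2 >= 4 t^4 / pi^4] this mass is controlled by the first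
    three coefficients of [K], through [3 - 4 rho_1 + rho_2 <= 4 pi^2 / (d + 2)^3].
    Integrals against [K] are expressed with explicit primitives. *)

(** * Derivative tests and elementary trigonometric inequalities *)

Section Calculus.
Variable R : realType.
Implicit Types (f df : R -> R).

Lemma is_derive_MVT f df (a b : R) : a < b ->
  (forall x : R, is_derive x 1 f (df x)) ->
  exists2 x, a < x < b & f b - f a = df x * (b - a).
Proof.
move=> ab dfP.
have [x xab fE] : exists2 c, c \in `]a, b[%R & f b - f a = df c * (b - a).
  apply: MVT => //; apply: derivable_within_continuous => x _.
  exact: (@ex_derive _ _ _ _ _ _ _ (dfP x)).
by exists x => //; move: xab; rewrite in_itv.
Qed.

Lemma is_derive_ge0_le f df (a b : R) : a <= b ->
  (forall x : R, is_derive x 1 f (df x)) ->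
  (forall x, a < x < b -> 0 <= df x) -> f a <= f b.
Proof.
rewrite le_eqVlt => /predU1P[->//|ab] dfP df_ge0.
have [x xab fE] := is_derive_MVT ab dfP.
rewrite -subr_ge0 fE mulr_ge0 ?df_ge0// subr_ge0; exact: ltW.
Qed.

Lemma is_derive_ext f g (x l : R) : f =1 g -> is_derive x 1 f l ->
  is_derive x 1 g l.
Proof. by move=> /boolp.funext ->. Qed.

Lemma is_derive_sin_nat (k : nat) (x : R) :
  is_derive x 1 (fun t => sin (k%:R * t)) (k%:R * cos (k%:R * x)).
Proof.
have dk : is_derive x 1 (fun t : R => k%:R * t) k%:R.
  have := is_deriveZ k%:R (is_derive_id x (1 : R)).
  by rewrite /GRing.scale/= mulr1; apply: is_derive_ext.
by rewrite mulrC; apply: (@is_derive1_comp _ sin).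
Qed.

Lemma sin_le_id (x : R) : 0 <= x -> sin x <= x.
Proof.
move=> x0; have : (0 : R) - sin 0 <= x - sin x.
  apply: (@is_derive_ge0_le (fun t => t - sin t) (fun t => 1 - cos t)) => //.
  by move=> t _; rewrite subr_ge0 cos_le1.
by rewrite sin0; lra.
Qed.

Lemma sqr_sin_le (x : R) : sin x ^+ 2 <= x ^+ 2.
Proof.
wlog x0 : x / 0 <= x.
  move=> wl; have [/wl//|/ltW x0] := leP 0 x.
  by have := wl (- x); rewrite sinN !sqrrN oppr_ge0; apply.
have [xpi|xpi] := leP x pi.
  by rewrite lerXn2r ?nnegrE ?sin_ge0_pi ?x0 ?sin_le_id.
rewrite (@le_trans _ _ 1)//.
  by have := cos2Dsin2 x; have := sqr_ge0 (cos x); lra.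
by have := pi_ge2 R; nra.
Qed.

(** If the inequality failed at [x], the mean slope of [sin] would be below [2 / pi] on [[0, x]] and
    above it on [[x, pi / 2]], although its derivative [cos] decreases. *)
Lemma Jordan_sin (x : R) : 0 <= x <= pi / 2 -> 2 * x / pi <= sin x.
Proof.
move=> /andP[x0 xpi]; rewrite leNgt; apply/negP => sinx.
have pi0 := @pi_gt0 R.
have xgt0 : 0 < x.
  rewrite lt_neqAle x0 andbT; apply/eqP => xE; move: sinx.
  by rewrite -xE mulr0 mul0r sin0 ltxx.
have xlt : x < pi / 2.
  rewrite lt_neqAle xpi andbT; apply/eqP => xE; move: sinx.
  by rewrite xE sin_pihalf [2 * _]mulrC divfK ?pnatr_eq0// divff ?ltxx// lt0r_neq0.
have [u /andP[u0 ux]] := is_derive_MVT xgt0 (@is_derive_sin R).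
have [v /andP[xv vp]] := is_derive_MVT xlt (@is_derive_sin R).
rewrite sin0 sin_pihalf !subr0 => sv su.
have : cos v < cos u.
  by rewrite ltr_cos ?in_itv/=; lra.
have cosu : cos u < 2 / pi.
  by rewrite -(ltr_pM2r xgt0) -su mulrAC.
suff : 2 / pi < cos v by lra.
rewrite -(@ltr_pM2r _ (pi / 2 - x)) ?subr_gt0// -sv.
have -> : 2 / pi * (pi / 2 - x) = 1 - 2 * x / pi
  by move: (pi : R) (lt0r_neq0 pi0) => p p0; field.
lra.
Qed.

Lemma one_sub_cosE (x : R) : 1 - cos x = 2 * sin (x / 2) ^+ 2.
Proof.
have {1}-> : x = (x / 2) *+ 2 by rewrite -mulr_natr divfK ?pnatr_eq0.
by rewrite cos_mulr2n sin2cos2; ring.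
Qed.

Lemma one_sub_cos_le (x : R) : 0 <= x -> 1 - cos x <= x ^+ 2 / 2.
Proof.
move=> x0; rewrite one_sub_cosE.
have x2 : 0 <= x / 2 by lra.
have := sqr_sin_le (x / 2); lra.
Qed.

Lemma one_sub_cos_ge (x : R) : 0 <= x <= pi -> 2 * x ^+ 2 / pi ^+ 2 <= 1 - cos x.
Proof.
move=> /andP[x0 xpi]; have pi0 := @pi_gt0 R; rewrite one_sub_cosE.
have : 2 * (x / 2) / pi <= sin (x / 2) by apply: Jordan_sin; lra.
have -> : 2 * (x / 2) / pi = x / pi.
  by move: (pi : R) (lt0r_neq0 pi0) => p p0; field.
move=> h; rewrite -mulrA ler_pM2l ?ltr0n// -expr_div_n.
have xpi_ge0 : 0 <= x / pi by rewrite divr_ge0// ltW.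
by rewrite lerXn2r ?nnegrE// (le_trans xpi_ge0 h).
Qed.

(** Expanding [cos pi = -1] by the triple-angle formula gives [4 c^3 - 3 c + 1 = (c + 1) (2 c - 1)^2
    = 0], and [c > 0] excludes the root [-1]. *)
Lemma cos_pi3 : cos (pi / 3) = 2^-1 :> R.
Proof.
have pi0 := @pi_gt0 R.
have c_gt0 : 0 < cos (pi / 3 : R) by apply: cos_gt0_pihalf; lra.
have : cos (pi / 3 + (pi / 3) *+ 2) = - 1 :> R.
  by rewrite -[RHS]cospi; congr cos; move: (pi : R) => p; field.
rewrite cosD cos_mulr2n sin_mulr2n.
have := cos2Dsin2 (pi / 3 : R).
move: (cos _) (sin _) c_gt0 => c s c_gt0 cs h.
have : (c + 1) * (2 * c - 1) ^+ 2 = 0.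
  have -> : (c + 1) * (2 * c - 1) ^+ 2
    = c * (c ^+ 2 *+ 2 - 1) - s * ((c * s) *+ 2) + 1
      + 2 * c * (c ^+ 2 + s ^+ 2 - 1) by ring.
  by rewrite h cs; ring.
move/eqP; rewrite mulf_eq0 sqrf_eq0 => /orP[] /eqP; lra.
Qed.

(** Comes from [sin (pi / 3)^2 = 3 / 4 <= (pi / 3)^2]. The constant is exactly what the case [d = 1]
    of [jackson_moment_le] requires. *)
Lemma sqr_pi_ge : 27 / 4 <= pi ^+ 2 :> R.
Proof.
have := sqr_sin_le (pi / 3 : R); rewrite sin2cos2 cos_pi3 expr_div_n; lra.
Qed.

End Calculus.

(** * Nonnegativity of the Jackson kernel *)

Section JacksonKernel.
Variable R : realType.
Implicit Types (t x : R) (d j k m : nat).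

(** The left side is the squared modulus of the sum of [a k * exp (i k t)]. Grouping the cross terms
    by the lag [j.+1] produces the autocorrelations of [a]. *)
Lemma sqr_norm_trig_poly (a : nat -> R) t m :
  (\sum_(0 <= k < m) a k * cos (k%:R * t)) ^+ 2
  + (\sum_(0 <= k < m) a k * sin (k%:R * t)) ^+ 2
  = \sum_(0 <= k < m) a k ^+ 2
    + 2 * \sum_(0 <= j < m)
            (\sum_(0 <= k < m - j.+1) a k * a (k + j.+1)%N) * cos (j.+1%:R * t).
Proof.
elim: m => [|m IHm]; first by rewrite !big_geq//; ring.
rewrite !(@big_nat_recr _ _ _ m)//= subnn (@big_geq _ _ _ 0 0)// mul0r addr0.
(* The new coefficient [a m] meets each earlier [a k] once, at lag [m - k]; reversing the sum over
   [k] indexes these terms by lag. *)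
have -> : \sum_(0 <= j < m)
      (\sum_(0 <= k < m.+1 - j.+1) a k * a (k + j.+1)%N) * cos (j.+1%:R * t)
    = \sum_(0 <= j < m)
      (\sum_(0 <= k < m - j.+1) a k * a (k + j.+1)%N) * cos (j.+1%:R * t)
    + a m * (\sum_(0 <= k < m) a k * cos (k%:R * t) * cos (m%:R * t)
    + \sum_(0 <= k < m) a k * sin (k%:R * t) * sin (m%:R * t)).
  rewrite -big_split/= [X in _ + a m * X]big_nat_rev/= mulr_sumr -big_split/=.
  apply: eq_big_nat => j /andP[_ jm].
  rewrite add0n subSS -(subnSK jm) big_nat_recr//= subnK// mulrDl; congr (_ + _).
  have -> : j.+1%:R * t = m%:R * t - (m - j.+1)%:R * t.
    by rewrite -mulrBl natrB// opprB addrC subrK.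
  by rewrite cosB; ring.
rewrite mulrDr addrACA -IHm -!mulr_suml.
have -> : a m ^+ 2 = a m ^+ 2 * (cos (m%:R * t) ^+ 2 + sin (m%:R * t) ^+ 2).
  by rewrite cos2Dsin2 mulr1.
ring.
Qed.

(** Each product is a difference of two cosines: one is independent of [k], the other telescopes
    once multiplied by [2 sin t]. *)
Lemma sum_sinM t j m :
  4 * sin t * \sum_(0 <= k < m) (sin (k.+1%:R * t) * sin ((k + j).+1%:R * t))
  = 2 * m%:R * sin t * cos (j%:R * t)
    - sin ((2 * m + j).+1%:R * t) + sin (j.+1%:R * t).
Proof.
elim: m => [|m IHm]; first by rewrite big_geq// muln0 !add0n; ring.
rewrite big_nat_recr//= mulrDr IHm.
have -> : (2 * m.+1 + j).+1%:R * t = m.+1%:R * t + (m + j).+1%:R * t + t.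
  by ring.
have -> : (2 * m + j).+1%:R * t = m.+1%:R * t + (m + j).+1%:R * t - t.
  by ring.
have -> : j%:R * t = (m + j).+1%:R * t - m.+1%:R * t.
  by ring.
rewrite cosB [in RHS]sinD sinB sinD cosD; ring.
Qed.

Lemma sin_pi_div_gt0 d : 0 < sin (pi / (d + 2)%:R) :> R.
Proof.
have pi0 := @pi_gt0 R; apply: sin_gt0_pi.
rewrite divr_gt0 ?ltr0n ?addn2//= ltr_pdivrMr ?ltr0n// ltr_pMr//.
by rewrite ltr1n.
Qed.

(* The Jackson coefficients are the autocorrelation of the sequence
   [sin ((k + 1) pi / (d + 2))]. *)
Lemma rho_coef_autocorr d j : (j <= d.+1)%N ->
  (d + 2)%:R * rho_coef R d j
  = 2 * \sum_(0 <= k < d.+1 - j)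
          (sin (k.+1%:R * (pi / (d + 2)%:R))
           * sin ((k + j).+1%:R * (pi / (d + 2)%:R))).
Proof.
move=> jd; rewrite /rho_coef; have s0 := sin_pi_div_gt0 d.
have N0 : (d + 2)%:R != 0 :> R by rewrite pnatr_eq0 addn2.
set t := pi / (d + 2)%:R in s0 *; set T := \sum_(0 <= k < _) _.
have NtE : (d + 2)%:R * t = pi by rewrite /t mulrC divfK.
have := sum_sinM t j (d.+1 - j); rewrite -/T.
(* The index equals [2 (d + 2) - (j + 1)], and [(d + 2) t = pi]. *)
have -> : (2 * (d.+1 - j) + j).+1%:R * t = pi *+ 2 - j.+1%:R * t.
  by rewrite -NtE -natr1 natrD natrM (natrB _ jd); ring.
have -> : j.+1%:R * t = j%:R * t + t by ring.
rewrite sinB sin2pi cos2pi natrB// mul0r mul1r sub0r opprK sinD => TE.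
apply: (mulIf (lt0r_neq0 s0)).
have -> : 2 * T * sin t = 4 * sin t * T / 2 by field.
rewrite {}TE; field.
by rewrite lt0r_neq0// -natrD.
Qed.

Lemma rho_coef0 d : rho_coef R d 0 = 1.
Proof.
rewrite /rho_coef mul0r cos0 sin0 subr0 mulr1 mulr0 addr0 divff//.
by rewrite mulf_neq0 ?pnatr_eq0 ?addn2// lt0r_neq0// -addn2 sin_pi_div_gt0.
Qed.

(** Real form of the sum of [rho_|k| exp (i k t)] over [|k| <= d]; the constant term is
    [rho_0 = 1]. *)
Definition jackson_kernel d t : R :=
  1 + 2 * \sum_(j < d) rho_coef R d j.+1 * cos (j.+1%:R * t).

Lemma jackson_kernel_ge0 d t : 0 <= jackson_kernel d t.
Proof.
rewrite -(@pmulr_rge0 _ (d + 2)%:R) ?ltr0n ?addn2// -addn2.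
(* By [rho_coef_autocorr], the autocorrelations of this sequence are the kernel coefficients up to
   the factor [(d + 2) / 2]. *)
pose a k : R := sin (k.+1%:R * (pi / (d + 2)%:R)).
suff -> : (d + 2)%:R * jackson_kernel d t =
    2 * ((\sum_(0 <= k < d.+1) a k * cos (k%:R * t)) ^+ 2
         + (\sum_(0 <= k < d.+1) a k * sin (k%:R * t)) ^+ 2).
  by rewrite mulr_ge0// addr_ge0// sqr_ge0.
rewrite sqr_norm_trig_poly mulrDr [RHS]mulrDr mulr1; congr (_ + _).
  have := rho_coef_autocorr (leq0n d.+1); rewrite rho_coef0 mulr1 => ->.
  by congr (2 * _); apply: eq_big_nat => k _; rewrite addn0.
rewrite big_nat_recr//= subnn (@big_geq _ _ _ 0 0)// mul0r addr0.
rewrite big_mkord mulrCA; congr (2 * _).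
rewrite !mulr_sumr; apply: eq_bigr => j _.
rewrite [LHS]mulrA [RHS]mulrA rho_coef_autocorr; last by rewrite ltnS ltnW.
by congr (_ * _ * _); apply: eq_big_nat => k _; rewrite /a addnS.
Qed.

End JacksonKernel.

(** * Moments and tail mass of the Jackson kernel *)

Section JacksonTail.
Variable R : realType.
Implicit Types (f g : R -> R) (t x u : R) (d j k m : nat).

Lemma is_derive_bigsum (I : Type) (r : seq I) (F : I -> R -> R) (dF : I -> R) x :
  (forall i, is_derive x 1 (F i) (dF i)) ->
  is_derive x 1 (fun t => \sum_(i <- r) F i t) (\sum_(i <- r) dF i).
Proof.
move=> dFP; elim: r => [|i r IHr].
  rewrite big_nil; apply: is_derive_ext (is_derive_cst 0 x 1) => t.
  by rewrite big_nil.
rewrite big_cons; apply: is_derive_ext (is_deriveD (dFP i) IHr) => t.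
by rewrite big_cons.
Qed.

Lemma is_derive_scale f c x l : is_derive x 1 f l ->
  is_derive x 1 (fun t => c * f t) (c * l).
Proof. exact: is_deriveZ. Qed.

(** The primitive of the kernel vanishing at [0]. It stands for the integral of the kernel over
    [[0, t]]; it is odd and nondecreasing, and equals [pi] at [pi]. *)
Definition jackson_primitive d t : R :=
  t + 2 * \sum_(j < d) rho_coef R d j.+1 / j.+1%:R * sin (j.+1%:R * t).

Lemma is_derive_jackson_primitive d x :
  is_derive x 1 (jackson_primitive d) (jackson_kernel d x).
Proof.
apply: is_deriveD; apply: is_derive_scale; apply: is_derive_bigsum => j.
have := is_derive_scale (rho_coef R d j.+1 / j.+1%:R) (is_derive_sin_nat j.+1 x).
by rewrite mulrA divfK ?pnatr_eq0.
Qed.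

Lemma jackson_primitive_le d t u : t <= u ->
  jackson_primitive d t <= jackson_primitive d u.
Proof.
move=> tu; apply: (is_derive_ge0_le tu (is_derive_jackson_primitive d)) => x _.
exact: jackson_kernel_ge0.
Qed.

Lemma jackson_primitiveN d t : jackson_primitive d (- t) = - jackson_primitive d t.
Proof.
rewrite /jackson_primitive opprD -mulrN -sumrN; congr (_ + 2 * _).
by apply: eq_bigr => j _; rewrite mulrN sinN mulrN.
Qed.

Lemma sin_nat_pi k : sin (k%:R * pi) = 0 :> R.
Proof.
elim: k => [|k IHk]; first by rewrite mul0r sin0.
by rewrite -natr1 mulrDl mul1r sinDpi IHk oppr0.
Qed.

Lemma sin_nat_2pi_sub k t : sin (k%:R * (2 * pi - t)) = - sin (k%:R * t) :> R.
Proof.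
have -> : k%:R * (2 * pi - t) = - (k%:R * t) + (pi *+ 2) *+ k.
  by move: (pi : R) => p; ring.
by rewrite periodicn ?sinN//; exact: sinD2pi.
Qed.

Lemma jackson_primitive_2pi_sub d t :
  jackson_primitive d (2 * pi - t) = 2 * pi - jackson_primitive d t.
Proof.
rewrite /jackson_primitive opprD addrA -[in RHS]mulrN -sumrN; congr (_ + 2 * _).
by apply: eq_bigr => j _; rewrite sin_nat_2pi_sub mulrN.
Qed.

Lemma jackson_primitive_pi d : jackson_primitive d pi = pi.
Proof.
rewrite /jackson_primitive big1 ?mulr0 ?addr0// => j _.
by rewrite sin_nat_pi mulr0.
Qed.

(* [half_mean f c] says that [f] has mean value [c] over [[0, pi]], witnessed by
   a primitive instead of an integral. *)
Definition half_mean f (c : R) := exists F : R -> R,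
  [/\ forall x, is_derive x 1 F (f x), F 0 = 0 & F pi = pi * c].

Lemma half_mean_ext f g c : f =1 g -> half_mean f c -> half_mean g c.
Proof. by move=> /boolp.funext ->. Qed.

Lemma half_meanD f g a b : half_mean f a -> half_mean g b ->
  half_mean (fun t => f t + g t) (a + b).
Proof.
move=> [F [dF F0 Fpi]] [G [dG G0 Gpi]]; exists (fun t => F t + G t).
split; [by move=> x; exact: is_deriveD | by rewrite F0 G0 addr0 |].
by rewrite Fpi Gpi mulrDr.
Qed.

Lemma half_meanZ f a c : half_mean f c -> half_mean (fun t => a * f t) (a * c).
Proof.
move=> [F [dF F0 Fpi]]; exists (fun t => a * F t).
split; [by move=> x; exact: is_derive_scale | by rewrite F0 mulr0 |].
by rewrite Fpi mulrCA.
Qed.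

Lemma half_mean_sum (I : Type) (r : seq I) (f : I -> R -> R) (c : I -> R) :
  (forall i, half_mean (f i) (c i)) ->
  half_mean (fun t => \sum_(i <- r) f i t) (\sum_(i <- r) c i).
Proof.
move=> fc; elim: r => [|i r IHr].
  exists (fun => 0); rewrite big_nil mulr0; split => // x; rewrite big_nil.
  exact: is_derive_cst.
rewrite big_cons; apply: half_mean_ext (half_meanD (fc i) IHr) => t.
by rewrite big_cons.
Qed.

Lemma half_mean_cos k : half_mean (fun t => cos (k%:R * t)) (k == 0)%:R.
Proof.
case: k => [|k].
  exists id; split; rewrite ?mulr1// => x; rewrite mul0r cos0.
  exact: is_derive_id.
exists (fun t => k.+1%:R^-1 * sin (k.+1%:R * t)); split.
- move=> x; have := is_derive_scale k.+1%:R^-1 (is_derive_sin_nat k.+1 x).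
  by rewrite mulKf ?pnatr_eq0.
- by rewrite mulr0 sin0 mulr0.
- by rewrite sin_nat_pi !mulr0.
Qed.

(** Orthogonality of the cosines. Taking the second index positive avoids the exceptional value [1]
    for two constant modes. *)
Lemma half_mean_cosM k m :
  half_mean (fun t => cos (k%:R * t) * cos (m.+1%:R * t)) ((k == m.+1)%:R / 2).
Proof.
(* Ordering the indices makes [m.+1 - k] a genuine difference. The case [k = 0] is already ordered,
   so a swap always leaves a positive second index. *)
wlog km : k m / (k <= m.+1)%N.
  case: k => [|k] wl; first exact: wl.
  have [/wl//|/ltnW mk] := leqP k.+1 m.+1.
  by rewrite eq_sym; apply: half_mean_ext (wl _ _ mk) => t; rewrite mulrC.
have := half_meanZ 2^-1 (half_meanD (half_mean_cos (m.+1 + k)) (half_mean_cos (m.+1 - k))).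
have -> : (m.+1 - k == 0)%N = (k == m.+1) by rewrite subn_eq0 eqn_leq km.
rewrite /= add0r mulrC; apply: half_mean_ext => t.
by rewrite natrD natrB// mulrDl mulrBl cosD cosB; field.
Qed.

(* The coefficient is guarded because [rho_coef d j] is not a kernel coefficient
   for [j > d]. *)
Lemma half_mean_jackson_cos d m :
  half_mean (fun t => jackson_kernel d t * cos (m.+1%:R * t))
    (if (m < d)%N then rho_coef R d m.+1 else 0).
Proof.
have := half_meanD (half_mean_cos m.+1) (half_meanZ 2 (half_mean_sum (index_enum 'I_d)
  (fun j : 'I_d => half_meanZ (rho_coef R d j.+1) (half_mean_cosM j.+1 m)))).
set c := (X in half_mean _ X -> _).
have -> : c = if (m < d)%N then rho_coef R d m.+1 else 0.
  rewrite /c add0r mulr_sumr; case: ltnP => [md|dm].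
    rewrite (bigD1 (Ordinal md))//= eqxx mul1r big1 ?addr0; first by field.
    by move=> j; rewrite -val_eqE/= eqSS => /negPf ->; rewrite mul0r !mulr0.
  rewrite big1// => j _; rewrite eqSS ltn_eqF; first by rewrite mul0r !mulr0.
  exact: leq_trans (ltn_ord j) dm.
apply: half_mean_ext => t; rewrite /jackson_kernel [RHS]mulrDl mul1r -[in RHS]mulrA mulr_suml.
by congr (_ + 2 * _); apply: eq_bigr => j _; rewrite mulrA.
Qed.

Lemma half_mean_jackson d : half_mean (@jackson_kernel R d) 1.
Proof.
exists (jackson_primitive d); split.
- exact: is_derive_jackson_primitive.
- by have := jackson_primitiveN d 0; rewrite oppr0; lra.
- by rewrite mulr1 jackson_primitive_pi.
Qed.

Lemma rho_coef1 d : rho_coef R d 1 = cos (pi / (d + 2)%:R).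
Proof.
rewrite /rho_coef mul1r; have := lt0r_neq0 (sin_pi_div_gt0 R d).
have : (d + 2)%:R != 0 :> R by rewrite pnatr_eq0 addn2.
move: (d + 2)%:R (cos _) (sin _) => N c s N0 s0; field.
by rewrite s0.
Qed.

Lemma rho_coef2 d (c := cos (pi / (d + 2)%:R) : R) :
  rho_coef R d 2 = 2 * c ^+ 2 - 1 + 2 / (d + 2)%:R * (1 - c ^+ 2).
Proof.
rewrite /rho_coef mulr_natl cos_mulr2n sin_mulr2n /c.
have := lt0r_neq0 (sin_pi_div_gt0 R d).
have : (d + 2)%:R != 0 :> R by rewrite pnatr_eq0 addn2.
move: (d + 2)%:R (cos _) (sin _) => N {}c s N0 s0; field.
by rewrite N0.
Qed.

Lemma half_mean_sqr_one_sub_cos_jackson d (c := cos (pi / (d + 2)%:R) : R) :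
  half_mean (fun t => (1 - cos t) ^+ 2 * jackson_kernel d t)
    ((1 - c) ^+ 2 + (1 - c ^+ 2) / (d + 2)%:R).
Proof.
(* For [d <= 1] the guard of [half_mean_jackson_cos] replaces some coefficients by [0]; these values
   of [c] show that the closed form persists. *)
have c0 : d = 0%N -> c = 0 by move=> d0; rewrite /c d0 cos_pihalf.
have c1 : d = 1%N -> c = 2^-1 by move=> d1; rewrite /c d1 cos_pi3.
(* Uses [(1 - cos t)^2 = 3/2 - 2 cos t + cos (2 t) / 2]. *)
have := half_meanD (half_meanZ (3 / 2) (half_mean_jackson d))
  (half_meanD (half_meanZ (- 2) (half_mean_jackson_cos d 0))
              (half_meanZ 2^-1 (half_mean_jackson_cos d 1))).
set e := (X in half_mean _ X -> _).
have -> : e = (1 - c) ^+ 2 + (1 - c ^+ 2) / (d + 2)%:R.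
  rewrite /e rho_coef1 rho_coef2 -/c.
  case: d @c c0 c1 e => [|[|d]] c c0 c1 e /=.
  - by rewrite c0//; field.
  - by rewrite c1//; field.
  - have : (d.+2 + 2)%:R != 0 :> R by rewrite pnatr_eq0 addn2.
    by move: (_ + 2)%:R => N N0; field.
by apply: half_mean_ext => t; rewrite mul1r [2 * t]mulr_natl cos_mulr2n; field.
Qed.

(** With [N = d + 2] and [t = pi / N], the right side is [2 t^2 / N], and each summand is at most
    [t^2 / N]: the second as [1 - c^2 = sin t ^2], the first as [N (1 - c)^2 <= N t^4 / 4 = t^2 (t
    pi / 4)] with [t <= 1] and [pi <= 4]. This needs [N >= 4]; the cases [d = 0, 1] are computed. *)
Lemma jackson_moment_le d (c := cos (pi / (d + 2)%:R) : R) :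
  (1 - c) ^+ 2 + (1 - c ^+ 2) / (d + 2)%:R <= 2 * pi ^+ 2 / (d + 2)%:R ^+ 3.
Proof.
have pi0 := @pi_gt0 R; have pi4 : pi <= 4 :> R by have := pihalf_lt2 R; lra.
have pi2 := sqr_pi_ge R.
have N0 : 0 < (d + 2)%:R :> R by rewrite ltr0n addn2.
have [d2|d2] := leqP 2 d; last first.
  case: d d2 @c N0 => [|[|//]] _ c _.
    rewrite /c cos_pihalf; have -> : (0 + 2)%:R ^+ 3 = 8 :> R by ring.
    by rewrite add0n; move: (pi ^+ 2) pi2 => p; lra.
  rewrite /c cos_pi3; have -> : (1 + 2)%:R ^+ 3 = 27 :> R by ring.
  by rewrite add1n; move: (pi ^+ 2) pi2 => p; lra.
have N4 : 4 <= (d + 2)%:R :> R by rewrite ler_nat addn2.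
pose t : R := pi / (d + 2)%:R.
have t0 : 0 < t by rewrite divr_gt0.
have NtE : (d + 2)%:R * t = pi by rewrite mulrC divfK ?lt0r_neq0.
have -> : 2 * pi ^+ 2 / (d + 2)%:R ^+ 3 = 2 * t ^+ 2 / (d + 2)%:R.
  by rewrite /t; move: (pi : R) (d + 2)%:R (lt0r_neq0 N0) => p N Nn0; field.
have c_le : 1 - c ^+ 2 <= t ^+ 2 by rewrite -sin2cos2; exact: sqr_sin_le.
have h1 : 0 <= 1 - c by rewrite subr_ge0 cos_le1.
have h2 : 1 - c <= t ^+ 2 / 2 by apply: one_sub_cos_le; exact: ltW.
rewrite ler_pdivlMr// mulrDl divfK ?lt0r_neq0//.
have h3 : (1 - c) ^+ 2 * (d + 2)%:R <= t ^+ 2 / 2 * (t ^+ 2 / 2) * (d + 2)%:R.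
  by rewrite ler_pM2r// expr2 ler_pM.
suff : t ^+ 2 / 2 * (t ^+ 2 / 2) * (d + 2)%:R <= t ^+ 2 by lra.
have -> : t ^+ 2 / 2 * (t ^+ 2 / 2) * (d + 2)%:R
    = t ^+ 2 * (t * ((d + 2)%:R * t) / 4) by field.
rewrite NtE ler_piMr ?sqr_ge0// ler_pdivrMr// mul1r.
have t1 : t <= 1 by rewrite ler_pdivrMr// mul1r (le_trans pi4).
by rewrite (le_trans _ pi4)// ler_piMl// ltW.
Qed.

Lemma jackson_tail d t : 0 < t <= pi ->
  pi - jackson_primitive d t <= pi ^+ 7 / (2 * (d + 2)%:R ^+ 3 * t ^+ 4).
Proof.
move=> /andP[t0 tpi].
have [F [dF F0 Fpi]] := half_mean_sqr_one_sub_cos_jackson d.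
have Ft : 0 <= F t.
  rewrite -F0; apply: (is_derive_ge0_le (ltW t0) dF) => x _.
  by rewrite mulr_ge0 ?sqr_ge0 ?jackson_kernel_ge0.
pose w := (1 - cos t) ^+ 2.
(* Chebyshev's inequality in terms of primitives: on [[t, pi]] the weight [(1 - cos x)^2] is at
   least [w], so this difference is nondecreasing there. *)
have : F t - w * jackson_primitive d t <= F pi - w * jackson_primitive d pi.
  pose dG x := (1 - cos x) ^+ 2 * jackson_kernel d x - w * jackson_kernel d x.
  have dGP x : is_derive x 1 (fun x => F x - w * jackson_primitive d x) (dG x).
    apply: is_deriveB; apply: is_derive_scale.
    exact: is_derive_jackson_primitive.
  apply: (is_derive_ge0_le tpi dGP).
  move=> x /andP[tx xpi]; rewrite /dG -mulrBl mulr_ge0 ?jackson_kernel_ge0//.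
  rewrite subr_ge0 /w lerXn2r ?nnegrE ?subr_ge0 ?cos_le1// lerB//.
  by apply: ltW; rewrite ltr_cos ?in_itv/=; lra.
rewrite jackson_primitive_pi Fpi => h.
have N0 : 0 < (d + 2)%:R :> R by rewrite ltr0n addn2.
have pi0 := @pi_gt0 R.
have := jackson_moment_le d; move: h; set M := (X in pi * X) => h hM.
have wM : w * (pi - jackson_primitive d t) <= pi * M by lra.
have w_ge : (2 * t ^+ 2 / pi ^+ 2) ^+ 2 <= w.
  have ct := @one_sub_cos_ge R t.
  have t_ge0 : 0 <= 2 * t ^+ 2 / pi ^+ 2.
    by rewrite divr_ge0 ?sqr_ge0// mulr_ge0 ?sqr_ge0.
  rewrite lerXn2r ?nnegrE//; last by apply: ct; lra.
  by rewrite subr_ge0 cos_le1.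
have T_ge0 : 0 <= pi - jackson_primitive d t.
  by rewrite subr_ge0 -[leRHS](jackson_primitive_pi d) jackson_primitive_le.
have := le_trans (ler_wpM2r T_ge0 w_ge) wM.
move/le_trans => /(_ _ (ler_wpM2l (ltW pi0) hM)).
rewrite ler_pdivlMr; last by rewrite !mulr_gt0// exprn_gt0.
move: (pi - _) => T.
have q0 : 0 < pi ^+ 4 * (d + 2)%:R ^+ 3 / 2 :> R.
  by rewrite !mulr_gt0 ?exprn_gt0// invr_gt0.
rewrite -(ler_pM2r q0).
have := lt0r_neq0 N0; have := lt0r_neq0 pi0.
move: (pi : R) (d + 2)%:R => p N p0 Nn0.
congr (_ <= _); field; rewrite ?p0 ?Nn0//.
Qed.

End JacksonTail.

(** * Pointwise error of the smoothed indicator *)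

Section SmoothedIndicator.
Variable R : realType.
Implicit Types (cmin cmax t x : R) (d j : nat).

(** The scalar value [psi_d (cos t)], since [T_j (cos t) = cos (j t)]. *)
Definition psi_cos cmin cmax d t : R :=
  \sum_(j < d.+1) rho_coef R d j * eta_coef cmin cmax j * cos (j%:R * t).

(* [psi_d] is the convolution of the even indicator function of
   [beta < |t| < alpha] with the Jackson kernel. *)
Lemma psi_cosE cmin cmax d t (a := alpha_of cmin) (b := beta_of cmax) :
  2 * pi * psi_cos cmin cmax d t
  = jackson_primitive d (a + t) + jackson_primitive d (a - t)
    - jackson_primitive d (b + t) - jackson_primitive d (b - t).
Proof.
have pi0 := lt0r_neq0 (@pi_gt0 R).
rewrite /psi_cos big_ord_recl/= rho_coef0 mul0r cos0 mul1r mulr1 mulrDr.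
rewrite /jackson_primitive /eta_coef/= -/a -/b.
have -> : 2 * pi * ((a - b) / pi) = 2 * (a - b).
  by move: (pi : R) pi0 => p p0; field.
set s1 := \sum_(j < d) _; set s2 := \sum_(j < d) _; set s3 := \sum_(j < d) _.
set s4 := \sum_(j < d) _; set s5 := \sum_(j < d) _.
suff -> : 2 * pi * s1 = 2 * (s2 + s3 - s4 - s5) by ring.
rewrite -mulrA; congr (2 * _).
rewrite /s2 /s3 /s4 /s5 -big_split/= -!sumrB mulr_sumr.
apply: eq_bigr => j _; rewrite /bump/= add1n.
have jn0 : j.+1%:R != 0 :> R by rewrite pnatr_eq0.
move: (pi : R) pi0 => p p0.
(* Termwise this is [2 sin (j a) cos (j t) = sin (j (a + t)) + sin (j (a - t))], and likewise for
   [b]. *)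
rewrite ![j.+1%:R * (_ + _)]mulrDr !mulrN !sinD !sinN !cosN.
move: (j.+1%:R) jn0 (rho_coef _ _ _) => J J0 r.
move: (cos _) (cos _) (cos _) (sin _) (sin _) (sin _) => x1 x2 x3 x4 x5 x6.
by field; rewrite ?p0 ?J0.
Qed.

Section Bounds.
Variables (cmin cmax : R) (d : nat) (D t : R).
Let a := alpha_of cmin.
Let b := beta_of cmax.

Let G := @jackson_primitive R d.
Let e := pi ^+ 6 / (2 * (d + 2)%:R ^+ 3 * D ^+ 4) : R.

(** [jackson_tail] is applied at [D]; monotonicity of [G] carries the bound to every larger [x],
    possibly beyond [pi]. *)
Let tail x : 0 < D -> D <= x -> D <= pi -> pi - G x <= pi * e.
Proof.
move=> D_gt0 Dx Dpi; have := @jackson_tail R d D; rewrite D_gt0 Dpi => /(_ isT).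
rewrite exprS -mulrA -/e; apply: le_trans; rewrite lerB//.
exact: jackson_primitive_le.
Qed.

Let reflect x : G x = 2 * pi - G (2 * pi - x).
Proof. by rewrite /G jackson_primitive_2pi_sub; ring. Qed.

Let bound (w : R) : 2 * pi * w - 2 * (pi * e) <= 2 * pi * psi_cos cmin cmax d t ->
  2 * pi * psi_cos cmin cmax d t <= 2 * pi * w + 2 * (pi * e) ->
  `|w - psi_cos cmin cmax d t| <= e.
Proof.
have pi0 := @pi_gt0 R => lo hi.
have p2 : 0 < 2 * pi :> R by rewrite mulr_gt0.
rewrite ler_distl -(ler_pM2l p2) -[w <= _](ler_pM2l p2).
by apply/andP; split; lra.
Qed.

Let e_ge0 : 0 < D -> 0 <= pi * e.
Proof.
move=> D_gt0.
rewrite mulr_ge0 ?pi_ge0// divr_ge0 ?exprn_ge0 ?pi_ge0//.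
by rewrite !mulr_ge0 ?exprn_ge0// ltW.
Qed.

Lemma psi_cos_inside : 0 <= b -> b <= a -> a <= pi -> 0 <= t -> t <= pi -> 0 < D ->
  D <= a - t -> D <= t - b ->
  `|1 - psi_cos cmin cmax d t| <= e.
Proof.
move=> b0 ba api t0 tpi D0 Da Db; have e0 := e_ge0 D0; have Dpi : D <= pi by lra.
apply: bound; rewrite psi_cosE -/a -/b -/G.
  (* Lower bound: [G (a - t)] and [G (t - b)] each fall short of [pi] by at most one tail. *)
  have -> : G (b - t) = - G (t - b) by rewrite -[b - t]opprB /G jackson_primitiveN.
  have : G (b + t) <= G (a + t) by apply: jackson_primitive_le; lra.
  have := tail D0 Da Dpi; have := tail D0 Db Dpi; lra.
have -> : G (b - t) = - G (t - b) by rewrite -[b - t]opprB /G jackson_primitiveN.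
(* Upper bound: reflection about [pi] gives [G (a + t) + G (a - t) <= 2 pi], so the smoothed value
   never exceeds [1]. *)
rewrite [G (a + t)]reflect.
have : G (a - t) <= G (2 * pi - (a + t)) by apply: jackson_primitive_le; lra.
have : G (t - b) <= G (b + t) by apply: jackson_primitive_le; lra.
lra.
Qed.

(** Left refers to cosines below [cmin], hence to angles above [a]. The two tails start at [t - a]
    and at [2 pi - (a + t)], both at least [D]. *)
Lemma psi_cos_left : 0 <= b -> b <= a -> a <= pi -> 0 <= t -> t <= pi -> 0 < D ->
  D <= t - a -> `|0 - psi_cos cmin cmax d t| <= e.
Proof.
move=> b0 ba api t0 tpi D0 Da; have e0 := e_ge0 D0; have Dpi : D <= pi by lra.
have GN u v : G (u - v) = - G (v - u) by rewrite -[u - v]opprB /G jackson_primitiveN.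
apply: bound; rewrite psi_cosE -/a -/b -/G [G (a - t)]GN [G (b - t)]GN.
  have : G (b + t) <= G (a + t) by apply: jackson_primitive_le; lra.
  have : G (t - a) <= G (t - b) by apply: jackson_primitive_le; lra.
  lra.
rewrite [G (a + t)]reflect.
have : G (t - b) <= G (b + t) by apply: jackson_primitive_le; lra.
have := tail D0 Da Dpi.
have : D <= 2 * pi - (a + t) by lra.
move/(tail D0) => /(_ Dpi); lra.
Qed.

(** Here the angle lies below [b], and the two tails start at [b - t] and [b + t]. *)
Lemma psi_cos_right : 0 <= b -> b <= a -> a <= pi -> 0 <= t -> t <= pi -> 0 < D ->
  D <= b - t -> `|0 - psi_cos cmin cmax d t| <= e.
Proof.
move=> b0 ba api t0 tpi D0 Db; have e0 := e_ge0 D0; have Dpi : D <= pi by lra.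
apply: bound; rewrite psi_cosE -/a -/b -/G.
  have : G (b + t) <= G (a + t) by apply: jackson_primitive_le; lra.
  have : G (b - t) <= G (a - t) by apply: jackson_primitive_le; lra.
  lra.
rewrite [G (a + t)]reflect.
have : G (a - t) <= G (2 * pi - (a + t)) by apply: jackson_primitive_le; lra.
have := tail D0 Db Dpi.
have : D <= b + t by lra.
move/(tail D0) => /(_ Dpi); lra.
Qed.

End Bounds.
End SmoothedIndicator.

(** * From the minimal gap to the distance of each angle from the endpoints *)

Section ClosestCosines.
Variable R : realType.

Lemma foldr_minP (x : R) s :
  foldr Num.min x s \in x :: s /\ {in x :: s, forall y, foldr Num.min x s <= y}.
Proof.
elim: s => [|z s [IHin IHle]] /=; first by
  rewrite inE eqxx; split=> // y /[!inE] /eqP->.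
split.
  by rewrite minEle; case: ifP; rewrite !inE ?eqxx ?orbT//;
     move: IHin; rewrite inE => /orP[->//|->]; rewrite !orbT.
move=> y; rewrite !inE ge_min orbCA => /orP[/eqP->|ys]; first by rewrite lexx.
by rewrite IHle ?orbT// inE.
Qed.

Lemma foldr_maxP (x : R) s :
  foldr Num.max x s \in x :: s /\ {in x :: s, forall y, y <= foldr Num.max x s}.
Proof.
elim: s => [|z s [IHin IHle]] /=; first by
  rewrite inE eqxx; split=> // y /[!inE] /eqP->.
split.
  by rewrite maxEle; case: ifP; rewrite !inE ?eqxx ?orbT//;
     move: IHin; rewrite inE => /orP[->//|->]; rewrite !orbT.
move=> y; rewrite !inE le_max orbCA => /orP[/eqP->|ys]; first by rewrite lexx.
by rewrite IHle ?orbT// inE.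
Qed.

Lemma seqminP (s : seq R) x : x \in s ->
  exists m, [/\ seqmin s = Some m, m \in s & {in s, forall y, m <= y}].
Proof.
by case: s => // y s _; have [] := foldr_minP y s; exists (foldr Num.min y s).
Qed.

Lemma seqmaxP (s : seq R) x : x \in s ->
  exists m, [/\ seqmax s = Some m, m \in s & {in s, forall y, y <= m}].
Proof.
by case: s => // y s _; have [] := foldr_maxP y s; exists (foldr Num.max y s).
Qed.

Lemma acos_le : {in `[-1, 1] &, {homo (@acos R) : x y /~ x <= y}}.
Proof.
move=> x y xI yI yx; rewrite leNgt; apply/negP => h.
have := xI; have := yI; rewrite !in_itv/= => yI' xI'.
have : cos (acos x) < cos (acos y).
  by rewrite ltr_cos// in_itv/= ?acos_ge0 ?acos_lepi.
by rewrite !acosK// ltNge yx.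
Qed.

Lemma lmap_itv (z : R) : 0 <= z <= 1 -> lmap z \in `[-1, 1].
Proof. by move=> /andP[z0 z1]; rewrite in_itv/= /lmap; apply/andP; split; nra. Qed.

Lemma acos_lmap_le (y z : R) : 0 <= y -> y <= z -> z <= 1 ->
  acos (lmap z) <= acos (lmap y).
Proof.
move=> y0 yz z1; apply: acos_le; first by apply: lmap_itv; lra.
  by apply: lmap_itv; lra.
by rewrite /lmap lerB// ler_pM2l// lerXn2r ?nnegrE//; lra.
Qed.

Variables (n : nat) (cmin cmax : R) (c : 'I_n -> R).
Hypotheses (c_ge0 : forall i, 0 <= c i) (c_le1 : forall i, c i <= 1).

Let a := alpha_of cmin.
Let b := beta_of cmax.
Let Dm := Delta_min cmin cmax c.
Let th i := acos (lmap (c i)).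

(** Membership in the list of four candidates lets one statement serve all four gaps; [pmap id]
    keeps those that exist. *)
Let Delta_min_le (o : option R) (u z : R) :
  omap (fun z => `|acos (lmap z) - u|) o
    \in [:: omap (fun z => `|acos (lmap z) - a|) (c_il cmin cmax c);
            omap (fun z => `|acos (lmap z) - b|) (c_ir cmin cmax c);
            omap (fun z => `|acos (lmap z) - a|) (c_ol cmin c);
            omap (fun z => `|acos (lmap z) - b|) (c_or cmax c)] ->
  o = Some z -> Dm <= `|acos (lmap z) - u|.
Proof.
move=> + oE; rewrite oE/= /Dm /Delta_min -/a -/b; set s := [:: _; _; _; _] => os.
have zs : `|acos (lmap z) - u| \in pmap id s.
  by rewrite mem_pmap map_id.
have [m [-> _ mle]] := seqminP zs; exact: mle.
Qed.

Let mem_c (P : pred R) i : P (c i) ->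
  c i \in [seq c i | i <- enum 'I_n & P (c i)].
Proof. by move=> Pi; apply: map_f; rewrite mem_filter Pi mem_enum. Qed.

Let mem_cP (P : pred R) m : m \in [seq c i | i <- enum 'I_n & P (c i)] ->
  [/\ P m, 0 <= m & m <= 1].
Proof. by move=> /mapP[k + ->]; rewrite mem_filter => /andP[]. Qed.

(** The closest value on the side of [c i] lies between [c i] and the endpoint, so by monotonicity
    of [acos] its gap is at most that of [th i]. The weight [1/2] cannot occur: a value at an
    endpoint would force a zero gap. *)
Lemma PS_weight_cases i :
  0 <= cmin -> cmin <= cmax -> cmax <= 1 -> 0 < Dm ->
  [\/ [/\ PS_weight cmin cmax (c i) = 1, Dm <= a - th i & Dm <= th i - b],
      PS_weight cmin cmax (c i) = 0 /\ Dm <= th i - a |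
      PS_weight cmin cmax (c i) = 0 /\ Dm <= b - th i].
Proof.
move=> cmin_ge0 cmin_le cmax_le1 Dm0; rewrite /PS_weight.
have [ci_lt|ci_ge] := ltP (c i) cmin.
  have [m [mE]] := seqmaxP (@mem_c (fun x => x < cmin) i ci_lt).
  move=> /(@mem_cP (fun x => x < cmin))[/= mc m0 m1].
  move=> /(_ _ (@mem_c (fun x => x < cmin) i ci_lt)) im.
  constructor 2; split.
    by rewrite ltNge (ltW ci_lt)/= lt_eqF//= lt_eqF// (lt_le_trans ci_lt).
  have := @Delta_min_le (c_ol cmin c) a m; rewrite !inE eqxx !orbT => /(_ isT mE).
  have : acos (lmap m) <= th i by apply: acos_lmap_le => //.
  have : a <= acos (lmap m).
    by apply: acos_lmap_le; [|exact: ltW|lra].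
  by move=> am mt; rewrite ger0_norm; lra.
have [ci_gt|ci_le] := ltP cmax (c i).
  have [m [mE]] := seqminP (@mem_c (fun x => cmax < x) i ci_gt).
  move=> /(@mem_cP (fun x => cmax < x))[/= mc m0 m1].
  move=> /(_ _ (@mem_c (fun x => cmax < x) i ci_gt)) im.
  constructor 3; split.
    rewrite [c i < cmax]ltNge (ltW ci_gt)/= andbF gt_eqF//= ?gt_eqF//.
    exact: le_lt_trans ci_gt.
  have := @Delta_min_le (c_or cmax c) b m; rewrite !inE eqxx !orbT => /(_ isT mE).
  have : th i <= acos (lmap m) by apply: acos_lmap_le => //.
  have : acos (lmap m) <= b.
    by apply: acos_lmap_le; [lra|exact: ltW|].
  by move=> am mt; rewrite ler0_norm; lra.
have cii : cmin <= c i <= cmax by rewrite ci_ge.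
have Da : Dm <= a - th i.
  have [m [mE]] := seqminP (@mem_c (fun x => cmin <= x <= cmax) i cii).
  move=> /(@mem_cP (fun x => cmin <= x <= cmax))[/andP[mc1 mc2] m0 m1].
  move=> /(_ _ (@mem_c (fun x => cmin <= x <= cmax) i cii)) im.
  have := @Delta_min_le (c_il cmin cmax c) a m; rewrite !inE eqxx => /(_ isT mE).
  have : th i <= acos (lmap m) by apply: acos_lmap_le => //.
  have : acos (lmap m) <= a by apply: acos_lmap_le => //; lra.
  by move=> am mt; rewrite ler0_norm; lra.
have Db : Dm <= th i - b.
  have [m [mE]] := seqmaxP (@mem_c (fun x => cmin <= x <= cmax) i cii).
  move=> /(@mem_cP (fun x => cmin <= x <= cmax))[/andP[mc1 mc2] m0 m1].
  move=> /(_ _ (@mem_c (fun x => cmin <= x <= cmax) i cii)) im.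
  have := @Delta_min_le (c_ir cmin cmax c) b m; rewrite !inE eqxx orbT => /(_ isT mE).
  have : acos (lmap m) <= th i by apply: acos_lmap_le => //.
  have : b <= acos (lmap m) by apply: acos_lmap_le => //; lra.
  by move=> am mt; rewrite ger0_norm; lra.
constructor 1; split => //.
have -> : cmin < c i.
  rewrite lt_neqAle ci_ge andbT; apply/eqP => ciE.
  by move: Da; rewrite /th -ciE /a /alpha_of; lra.
suff -> : c i < cmax by [].
rewrite lt_neqAle ci_le andbT; apply/eqP => ciE.
by move: Db; rewrite /th ciE /b /beta_of; lra.
Qed.

End ClosestCosines.

(** * Traces in the basis given by the GSVD *)

Section GSVDTraces.
Variables (R : realType) (n : nat).

Lemma cheb_mx_diag (S X : 'M[R]_n) (th : 'I_n -> R) :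
  S *m X = X *m diag_mx (\row_i cos (th i)) ->
  forall j, cheb_mx S j *m X = X *m diag_mx (\row_i cos (j%:R * th i)).
Proof.
move=> SX j.
(* The recurrence has order two, so both components are carried; it matches [cos ((j + 2) u) = 2 cos
   u cos ((j + 1) u) - cos (j u)]. *)
suff [] : (cheb_pair S j).1 *m X = X *m diag_mx (\row_i cos (j%:R * th i))
  /\ (cheb_pair S j).2 *m X = X *m diag_mx (\row_i cos (j.+1%:R * th i)) by [].
elim: j => [|j [IH1 IH2]] /=.
  split; last by rewrite SX; congr (_ *m diag_mx _); apply/rowP => i; rewrite !mxE mul1r.
  rewrite mul1mx -[LHS]mulmx1; congr (_ *m _); apply/matrixP => i k.
  by rewrite !mxE mul0r cos0.
split=> //; rewrite mulmxBl -scalemxAl -mulmxA IH2 IH1 mulmxA SX -!mulmxA.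
rewrite mulmx_diag scalemxAr -mulmxBr -linearZ/= -linearB/=.
congr (_ *m diag_mx _); apply/rowP => i; rewrite !mxE.
have -> : j.+2%:R * th i = j.+1%:R * th i + th i by ring.
have -> : j%:R * th i = j.+1%:R * th i - th i by ring.
by rewrite cosB cosD; ring.
Qed.

Lemma mxtrace_conj (P X : 'M[R]_n) (v : 'rV_n) : X \in unitmx ->
  P *m X = X *m diag_mx v -> \tr P = \sum_i v 0 i.
Proof.
by move=> Xu PX; rewrite -(mulmxK Xu P) PX mxtrace_mulC mulKmx// mxtrace_diag.
Qed.

(** By cyclicity, each rank-one summand has trace [x_i^T H x_i], a diagonal entry of
    [X^T H X = I]. *)
Lemma mxtrace_PS_mx cmin cmax (c : 'I_n -> R) (X H : 'M[R]_n) :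
  X^T *m H *m X = 1%:M ->
  \tr (PS_mx cmin cmax c X H) = \sum_i PS_weight cmin cmax (c i).
Proof.
move=> XHX; rewrite /PS_mx raddf_sum/=; apply: eq_bigr => i _.
rewrite mxtraceZ -mulmxA mxtrace_mulC -[RHS]mulr1; congr (_ * _).
have -> : (col i X)^T *m H *m col i X = row i (col i (X^T *m H *m X)).
  by rewrite tr_col !colE !row_mul !mulmxA.
by rewrite XHX trace_mx11 !mxE eqxx.
Qed.

Lemma gram_conj m (A SigA : 'M[R]_(m, n)) (U : 'M[R]_m) (X : 'M[R]_n) :
  U^T *m U = 1%:M -> U^T *m A *m X = SigA ->
  X^T *m (A^T *m A) *m X = SigA^T *m SigA.
Proof.
move=> /mulmx1C UU <-; rewrite !trmx_mul trmxK !mulmxA.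
by rewrite -(mulmxA (X^T *m A^T) U) UU mulmx1.
Qed.

End GSVDTraces.

(** The normalization [X^T H X = I] amounts to [H^-1 = X X^T], which turns the second hypothesis
    into the eigenvalue equation. *)
Lemma eigen_gsvd (R : realType) (n : nat) (AA BB X : 'M[R]_n) (v : 'rV_n) :
  X^T *m (AA + BB) *m X = 1%:M -> X^T *m (AA - BB) *m X = diag_mx v ->
  invmx (AA + BB) *m (AA - BB) *m X = X *m diag_mx v.
Proof.
move=> XHX <-; move: XHX; rewrite -mulmxA => /mulmx1C HXX.
rewrite -mulmxA in HXX.
have [Hu _] := mulmx1_unit HXX.
have -> : invmx (AA + BB) = X *m X^T by rewrite -[RHS](mulKmx Hu) HXX mulmx1.
by rewrite !mulmxA.
Qed.

Lemma mxtrace_psi_mx (R : realType) (n : nat) (cmin cmax : R) (d : nat)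
    (S X : 'M[R]_n) (th : 'I_n -> R) : X \in unitmx ->
  S *m X = X *m diag_mx (\row_i cos (th i)) ->
  \tr (psi_mx cmin cmax d S) = \sum_i psi_cos cmin cmax d (th i).
Proof.
move=> Xu SX; rewrite /psi_mx raddf_sum/= /psi_cos [RHS]exchange_big/=.
apply: eq_bigr => j _; rewrite mxtraceZ (mxtrace_conj Xu (cheb_mx_diag SX j)).
by rewrite mulr_sumr; apply: eq_bigr => i _; rewrite mxE.
Qed.

(** Positivity of [Dm] is explicit because division by zero returns [0]: at [Dm = 0] the right side
    would read [0] instead of being infinite. *)
Theorem theorem3p4 (R : realType) (m1 m2 n : nat)
    (A : 'M[R]_(m1, n)) (B : 'M[R]_(m2, n))
    (U : 'M[R]_m1) (V : 'M[R]_m2) (X : 'M[R]_n)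
    (SigA : 'M[R]_(m1, n)) (SigB : 'M[R]_(m2, n))
    (c s : 'I_n -> R) (cmin cmax : R) (d : nat) :
  (n <= m1 + m2)%N ->
  \rank (col_mx A B) = n ->
  (* GSVD *)
  U^T *m U = 1%:M -> V^T *m V = 1%:M -> X \in unitmx ->
  U^T *m A *m X = SigA -> V^T *m B *m X = SigB ->
  SigA^T *m SigA = diag_mx (\row_i (c i) ^+ 2) ->
  SigB^T *m SigB = diag_mx (\row_i (s i) ^+ 2) ->
  (forall i, 0 <= c i) -> (forall i, 0 <= s i) ->
  (forall i, c i ^+ 2 + s i ^+ 2 = 1) ->
  (* the interval [cmin, cmax] in [0,1] *)
  0 <= cmin -> cmin <= cmax -> cmax <= 1 ->
  let H := A^T *m A + B^T *m B in
  let S := invmx H *m (A^T *m A - B^T *m B) in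
  let PS := PS_mx cmin cmax c X H in
  let P := psi_mx cmin cmax d S in
  let Dm := Delta_min cmin cmax c in
  0 < Dm ->
  `|\tr PS - \tr P| <= n%:R * pi ^+ 6 / (2 * (d + 2)%:R ^+ 3 * Dm ^+ 4).
Proof.
move=> _ _ UU VV Xu UAX VBX SA SB c0 _ cs cmin0 cmin_le cmax1 H S PS P Dm Dm0.
have c1 i : c i <= 1 by have := cs i; have := sqr_ge0 (s i); have := c0 i; nra.
have AX := gram_conj UU UAX; have BX := gram_conj VV VBX.
have XHX : X^T *m H *m X = 1%:M.
  rewrite /H mulmxDr mulmxDl AX BX SA SB -linearD/= -diag_const_mx.
  by congr diag_mx; apply/rowP => i; rewrite !mxE cs.
pose th i := acos (lmap (c i)).
have lmap_c i : lmap (c i) \in `[-1, 1]%R by rewrite lmap_itv// c0 c1.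
(* The eigenvalues are [c_i^2 - s_i^2 = 2 c_i^2 - 1 = cos (th i)]. *)
have SX : S *m X = X *m diag_mx (\row_i cos (th i)).
  apply: eigen_gsvd => //.
  rewrite mulmxBr mulmxBl AX BX SA SB -linearB/=.
  congr diag_mx; apply/rowP => i; rewrite !mxE acosK//.
  by rewrite /lmap; have := cs i; lra.
rewrite /PS (mxtrace_PS_mx _ _ _ XHX) /P (mxtrace_psi_mx _ _ _ Xu SX) -sumrB.
apply: le_trans (ler_norm_sum _ _ _) _.
(* The factor [n] becomes a constant sum over the indices, leaving one bound per angle. *)
rewrite -mulrA mulr_natl -[n in leRHS]card_ord -sumr_const.
apply: ler_sum => i _.
have b0 : 0 <= beta_of cmax.
  have : lmap cmax \in `[-1, 1]%R by rewrite lmap_itv// (le_trans cmin0).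
  by rewrite in_itv/=; exact: acos_ge0.
have ba : beta_of cmax <= alpha_of cmin by exact: acos_lmap_le.
have api : alpha_of cmin <= pi.
  have : lmap cmin \in `[-1, 1]%R by rewrite lmap_itv// cmin0 (le_trans cmin_le).
  by rewrite in_itv/=; exact: acos_lepi.
have := lmap_c i; rewrite in_itv/= => lci.
have th0 : 0 <= th i by exact: acos_ge0.
have thpi : th i <= pi by exact: acos_lepi.
have [[-> Da Db]|[-> Da]|[-> Db]] := PS_weight_cases c0 c1 i cmin0 cmin_le cmax1 Dm0.
- exact: psi_cos_inside.
- exact: psi_cos_left.
- exact: psi_cos_right.
Qed.
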